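(* Let $P,Q\in\mathbb F[D,D^{-1}]$ and let $L=\varphi^*P+Q\in\mathbb F[D,D^{-1},\varphi^*]$. Define $R:=\varphi^*P-\varphi^*(Q)\in\mathbb F[D,D^{-1},\varphi^*]$. Then $RL=LR$ and $RL\in\mathbb F[D,D^{-1}]$.
   Context: $\mathbb F$ is a field, $V$ a vector space over $\mathbb F$, and $\mathscr S$ is the $\mathbb F$-vector space of all functions $\mathbb Z\to V$ (two-sided sequences $x=(x_k)_{k\in\mathbb Z}$). The right shift operator $D:\mathscr S\to\mathscr S$ is $(Dx)_k=x_{k+1}$; it is bijective. The reflection pullback $\varphi^*:\mathscr S\to\mathscr S$ is $(\varphi^*x)_k=x_{-k}$. $\mathbb F[D,D^{-1}]$ denotes the commutative algebra of Laurent polynomials $\sum_{j\in\mathbb Z}a_jD^j$ with $a_j\in\mathbb F$, only finitely many nonzero, regarded as operators on $\mathscr S$. $\mathbb F[D,D^{-1},\varphi^*]$ denotes the algebra (under composition) of operators on $\mathscr S$ generated by $D^j$ and $\varphi^*D^j$, $j\in\mathbb Z$; products denote composition. For $P\in\mathbb F[D,D^{-1}]$, $\varphi^*(P)\in\mathbb F[D,D^{-1}]$ denotes the Laurent polynomial $\varphi^*(P)(D):=P(D^{-1})$ (to be distinguished from the composition $\varphi^*P$). *)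

(* Defs.v *)
From HB Require Import structures.
From mathcomp Require Import all_boot all_order all_algebra finmap.
From mathcomp Require Import boolp classical_sets functions.

Set Implicit Arguments.
Unset Strict Implicit.
Unset Printing Implicit Defensive.

Import Order.TTheory GRing.Theory Num.Theory.

Local Open Scope ring_scope.
Local Open Scope classical_set_scope.

(* Sequences and operators are plain functions; their vector-space structure
   is the pointwise one of mathcomp.classical.functions. *)
Notation sequences V := (int -> V) (only parsing).
Notation operator V := ((int -> V) -> (int -> V)) (only parsing).

Section Operators.
Variables (F : fieldType) (V : lmodType F).

Definition shift (x : sequences V) : sequences V := fun k => x (k + 1).
Definition shift_inv (x : sequences V) : sequences V := fun k => x (k - 1).

Lemma shiftK : cancel shift shift_inv.
Proof. by move=> x; apply/funext => k; rewrite /shift /shift_inv subrK. Qed.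

Lemma shift_invK : cancel shift_inv shift.
Proof. by move=> x; apply/funext => k; rewrite /shift /shift_inv addrK. Qed.

(* The integer power D^j; recall that [Negz n] is [- n.+1]. *)
Definition shift_pow (j : int) : operator V :=
  match j with
  | Posz n => iter n shift
  | Negz n => iter n.+1 shift_inv
  end.

Definition reflection (x : sequences V) : sequences V := fun k => x (- k).

End Operators.

Arguments shift_pow {F} V j.
Arguments reflection {F} V x.

(* A Laurent polynomial is a formal object, given by its finitely supported
   family of coefficients; [laurent_op] is the operator it defines.  The two
   can be identified unless V = 0. *)
Notation laurent F := {fsfun int -> F with 0}.

Definition laurent_op (F : fieldType) (V : lmodType F) (P : laurent F) :
    operator V :=
  \sum_(j <- finsupp P) P j *: shift_pow V j.

(* The Laurent polynomial P(D^-1), whose coefficient of D^j is that of D^-j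
   in P. *)
Definition laurent_reflection (F : fieldType) (P : laurent F) : laurent F :=
  [fsfun j in [fset - i | i in finsupp P]%fset => P (- j)].

Lemma laurent_reflectionE (F : fieldType) (P : laurent F) (j : int) :
  laurent_reflection P j = P (- j).
Proof.
rewrite fsfunE; case: ifPn => // /negP jP; apply/esym/fsfun_dflt/negP => Pj.
by apply: jP; apply/imfsetP; exists (- j); rewrite ?opprK.
Qed.

Arguments laurent_op {F} V P.

(* F[D, D^-1] as a set of operators. *)
Definition laurent_algebra (F : fieldType) (V : lmodType F) :
    set (operator V) :=
  range (laurent_op V).

Definition subalgebra (F : fieldType) (V : lmodType F)
    (A : set (operator V)) : Prop :=
  [/\ A id,
      forall (a : F) S T, A S -> A T -> A (a *: S + T)
    & forall S T, A S -> A T -> A (S \o T)].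

(* F[D, D^-1, phi^* ]: the algebra under composition generated by the D^j and
   the phi^* D^j. *)
Definition laurent_reflection_algebra (F : fieldType) (V : lmodType F) :
    set (operator V) :=
  smallest (@subalgebra F V)
    (range (shift_pow V) `|` range (fun j => reflection V \o shift_pow V j)).

Arguments laurent_algebra {F} V.
Arguments laurent_reflection_algebra {F} V.

(* Main.v *)
Require Import Defs.
From HB Require Import structures.
From mathcomp Require Import all_boot all_order all_algebra finmap.
From mathcomp Require Import boolp classical_sets functions.

(** Write [p], [q] for the operators of [P], [Q], [p'], [q'] for those of
    [P(D^-1)], [Q(D^-1)], and [f] for the reflection.  Two facts carry the
    proof.  Laurent operators commute with one another, because
    [D^i D^j = D^(i + j)] ([laurent_opC]); and moving a Laurent operator across
    the reflection exchanges [D] and [D^-1], so that [p f = f p']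
    ([laurent_op_reflection]), while [f f = 1].  Hence
    [R L = (f p - q') (f p + q) = p' p + f p q - f q p - q' q = p' p - q' q],
    [L R = (f p + q) (f p - q') = p' p - f p q' + f q' p - q q' = p' p - q q'],
    where the mixed terms cancel by commutativity, and the two results agree
    for the same reason.  Finally [p' p - q' q] is a Laurent operator since
    these form an algebra ([laurent_algebra_lin], [laurent_algebra_comp]). *)

Import GRing.Theory.

Local Open Scope ring_scope.
Local Open Scope classical_set_scope.

(** * Laurent operators as linear maps *)

Section LaurentOperators.
Set Implicit Arguments.
Unset Strict Implicit.
Variables (F : fieldType) (V : lmodType F).
Implicit Types (P Q : laurent F) (x : int -> V) (i j k : int).

Lemma shift_powE j x k : shift_pow V j x k = x (k + j).
Proof.
case: j => n /=.
  elim: n k => [|n IHn] k; first by rewrite addr0.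
  by rewrite iterS /shift IHn -addrA -intS.
rewrite NegzE -iterS; elim: n.+1 k => [|m IHm] k; first by rewrite subr0.
by rewrite iterS /shift_inv IHm -addrA intS opprD.
Qed.

(** Summing over a set larger than the support is what allows two Laurent
    polynomials to be added over a common index set. *)
Lemma laurent_op_supset P (A : {fset int}) : (finsupp P `<=` A)%fset ->
  laurent_op V P = \sum_(j <- A) P j *: shift_pow V j.
Proof.
move=> PA; rewrite /laurent_op; apply: big_fset_incl => // j _ jP.
by rewrite fsfun_dflt // scale0r.
Qed.

Lemma laurent_op_fsfun (A : {fset int}) (c : int -> F) :
  laurent_op V [fsfun j in A => c j] = \sum_(j <- A) c j *: shift_pow V j.
Proof.
rewrite (@laurent_op_supset _ A); last exact: finsupp_sub.
by apply: eq_big_seq => j jA; rewrite fsfunE jA.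
Qed.

Lemma laurent_opE P x k :
  laurent_op V P x k = \sum_(j <- finsupp P) P j *: x (k + j).
Proof.
rewrite /laurent_op !fct_sumE; apply: eq_bigr => j _.
by rewrite -shift_powE.
Qed.

Lemma laurent_op_linear P (a : F) x y :
  laurent_op V P (a *: x + y) = a *: laurent_op V P x + laurent_op V P y.
Proof.
apply/funext => k.
rewrite [RHS]/(_ *: laurent_op V P x k + laurent_op V P y k) !laurent_opE.
rewrite scaler_sumr -[RHS]big_split; apply: eq_bigr => j _ /=.
by rewrite scalerDr !scalerA mulrC.
Qed.

Lemma laurent_opD P x y :
  laurent_op V P (x + y) = laurent_op V P x + laurent_op V P y.
Proof. by rewrite -[x in LHS]scale1r laurent_op_linear scale1r. Qed.

Lemma laurent_opB P x y :
  laurent_op V P (x - y) = laurent_op V P x - laurent_op V P y.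
Proof. by rewrite addrC -scaleN1r laurent_op_linear scaleN1r addrC. Qed.

(** * Commutation rules *)

Lemma reflectionK : involutive (@reflection F V).
Proof. by move=> x; apply/funext => k; rewrite /reflection opprK. Qed.

Lemma laurent_opC P Q x :
  laurent_op V P (laurent_op V Q x) = laurent_op V Q (laurent_op V P x).
Proof.
apply/funext => k; rewrite !laurent_opE.
under eq_bigr do rewrite laurent_opE scaler_sumr.
under [RHS]eq_bigr do rewrite laurent_opE scaler_sumr.
rewrite exchange_big; apply: eq_bigr => i _; apply: eq_bigr => j _.
by rewrite !scalerA mulrC addrAC.
Qed.

(** Reflecting the index turns [k + j] into [k - j], that is, [D^j] into
    [D^-j]. *)
Lemma laurent_op_reflection P x :
  laurent_op V P (reflection V x) =
  reflection V (laurent_op V (laurent_reflection P) x).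
Proof.
apply/funext => k; rewrite /reflection laurent_opE.
rewrite /laurent_reflection laurent_op_fsfun !fct_sumE.
rewrite big_imfset /=; last by move=> i j _ _; apply: oppr_inj.
by apply: eq_bigr => j _; rewrite opprK opprD -shift_powE.
Qed.

Lemma reflection_laurent_op P x :
  laurent_op V (laurent_reflection P) (reflection V x) =
  reflection V (laurent_op V P x).
Proof.
by rewrite -[in RHS](reflectionK x) (laurent_op_reflection P) reflectionK.
Qed.

(** * The algebra of Laurent operators *)

Lemma laurent_algebra_lin (a : F) (S T : operator V) :
  laurent_algebra V S -> laurent_algebra V T -> laurent_algebra V (a *: S + T).
Proof.
move=> [P _ <-] [Q _ <-].
set A := (finsupp P `|` finsupp Q)%fset.
exists [fsfun j in A => a * P j + Q j] => //.
rewrite laurent_op_fsfun.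
rewrite (laurent_op_supset (fsubsetUl (finsupp P) (finsupp Q))).
rewrite (laurent_op_supset (fsubsetUr (finsupp P) (finsupp Q))).
rewrite scaler_sumr -big_split; apply: eq_bigr => j _ /=.
by rewrite scalerDl scalerA.
Qed.

Lemma laurent_algebra0 : laurent_algebra V 0.
Proof. by exists [fsfun] => //; rewrite /laurent_op finsupp0 big_nil. Qed.

Lemma laurent_algebra_shift_pow j : laurent_algebra V (shift_pow V j).
Proof.
exists [fsfun i in [fset j]%fset => 1] => //.
by rewrite laurent_op_fsfun big_seq_fset1 scale1r.
Qed.

(** This serves both algebras of operators: each contains the shifts, so each
    contains whatever is written as a finite combination of shifts. *)
Lemma lin_closed_sum (A : set (operator V)) (I : Type) (r : seq I)
    (c : I -> F) (S : I -> operator V) :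
  A 0 -> (forall a T U, A T -> A U -> A (a *: T + U)) ->
  (forall n, A (S n)) -> A (\sum_(n <- r) c n *: S n).
Proof.
move=> A0 Alin AS; elim: r => [|n r IHr]; first by rewrite big_nil.
by rewrite big_cons; apply: Alin.
Qed.

(** Expanding both factors and using [D^i D^j = D^(i + j)] writes the
    composition as a double linear combination of shifts; closure under
    combinations then replaces a computation of the convolved coefficients. *)
Lemma laurent_algebra_comp (S T : operator V) :
  laurent_algebra V S -> laurent_algebra V T -> laurent_algebra V (S \o T).
Proof.
move=> [P _ <-] [Q _ <-].
have -> : laurent_op V P \o laurent_op V Q = \sum_(i <- finsupp P) P i *:
    \sum_(j <- finsupp Q) Q j *: shift_pow V (i + j).
  apply/funext => x; apply/funext => k; rewrite /= laurent_opE !fct_sumE.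
  apply: eq_bigr => i _; rewrite laurent_opE.
  rewrite [RHS]/(_ *: (\sum_(j <- finsupp Q) Q j *: shift_pow V (i + j)) x k).
  rewrite !fct_sumE; congr (_ *: _); apply: eq_bigr => j _.
  by rewrite -addrA -shift_powE.
have lin := laurent_algebra_lin; have zero := laurent_algebra0.
do 2![apply: lin_closed_sum => // ?].
exact: laurent_algebra_shift_pow.
Qed.

(** * Membership in the algebra generated by shifts and reflection *)

Lemma laurent_reflection_algebra_subalgebra :
  subalgebra (laurent_reflection_algebra V).
Proof.
split=> [B [[B1 _ _] _]|a S T AS AT B BP|S T AS AT B BP] //;
  have [[_ Blin Bcomp] _] := BP.
- by apply: Blin; [apply: AS | apply: AT].
- by apply: Bcomp; [apply: AS | apply: AT].
Qed.

Lemma laurent_reflection_algebra0 : laurent_reflection_algebra V 0.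
Proof.
have [A1 Alin _] := laurent_reflection_algebra_subalgebra.
by rewrite -[0](addNr (id : operator V)) -scaleN1r; apply: Alin.
Qed.

Lemma laurent_op_in_reflection_algebra P :
  laurent_reflection_algebra V (laurent_op V P).
Proof.
have [_ Alin _] := laurent_reflection_algebra_subalgebra.
apply: (@lin_closed_sum (laurent_reflection_algebra V)) => // [|j B [_ AB]].
  exact: laurent_reflection_algebra0.
by apply: AB; left; exists j.
Qed.

Lemma reflection_in_reflection_algebra :
  laurent_reflection_algebra V (reflection V).
Proof. by move=> B [_]; apply; right; exists 0. Qed.

End LaurentOperators.

Theorem theorem2p3 (F : fieldType) (V : lmodType F) (P Q : laurent F) :
  let L : operator V := (reflection V \o laurent_op V P) + laurent_op V Q in
  let R : operator V :=
    (reflection V \o laurent_op V P) - laurent_op V (laurent_reflection Q) in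
  [/\ laurent_reflection_algebra V L,
      laurent_reflection_algebra V R,
      R \o L = L \o R
    & laurent_algebra V (R \o L)].
Proof.
move=> L R.
have [_ Alin Acomp] := laurent_reflection_algebra_subalgebra V.
have Aop := @laurent_op_in_reflection_algebra F V.
have AfP : laurent_reflection_algebra V (reflection V \o laurent_op V P).
  by apply: Acomp => //; apply: reflection_in_reflection_algebra.
pose p := laurent_op V P; pose q := laurent_op V Q.
pose p' := laurent_op V (laurent_reflection P).
pose q' := laurent_op V (laurent_reflection Q).
pose f := reflection V.
have fD x y : f (x + y) = f x + f y by [].
have fB x y : f (x - y) = f x - f y by [].
have RLE : R \o L = - 1 *: (q' \o q) + (p' \o p).
  rewrite scaleN1r addrC; apply/funext => x.
  change (f (p (f (p x) + q x)) - q' (f (p x) + q x) = p' (p x) - q' (q x)).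
  rewrite /p /q /p' /q' !laurent_opD fD /f.
  rewrite laurent_op_reflection reflectionK reflection_laurent_op.
  by rewrite (laurent_opC Q P) opprD addrA addrK.
have LRE : L \o R = - 1 *: (q' \o q) + (p' \o p).
  rewrite scaleN1r addrC; apply/funext => x.
  change (f (p (f (p x) - q' x)) + q (f (p x) - q' x) = p' (p x) - q' (q x)).
  rewrite /p /q /p' /q' !laurent_opB fB /f.
  rewrite !laurent_op_reflection reflectionK.
  rewrite (laurent_opC P) (laurent_opC Q).
  by rewrite addrA subrK.
split.
- by rewrite /L -[X in X + _]scale1r; apply: Alin.
- by rewrite /R addrC -scaleN1r; apply: Alin.
- by rewrite RLE LRE.
- rewrite RLE; apply: laurent_algebra_lin; apply: laurent_algebra_comp;
  by eexists.
Qed.
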